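(* Consider the Bayesian model with inverse gamma prior (parameters $\alpha,\beta>0$) on the error variance described in the context, with $L$ nondecreasing and $0<L(u)\le M<\infty$, and suppose $a+1<\alpha<a+2$. For any $0<u<1$ there is a constant $C>0$, not depending on $\tau$ or $X_i$, such that for all $0<\tau<1$ and every value of $X_i\neq0$, $$\mathbb{E}\big[\kappa_i\mathbf{1}_{\{\kappa_i\le u\}}\mid X_i\big]\le\frac{C}{X_i^2}.$$
   Context: Model (for given $\tau>0$): (i) $X_i\mid\theta_i,\sigma_i^2\sim N(\theta_i,\sigma_i^2)$ independently, $i=1,\dots,n$; (ii) $\theta_i\mid\sigma_i^2,\lambda_i^2,\tau^2\sim N(0,\sigma_i^2\lambda_i^2\tau^2)$ independently; (iii) $\lambda_1^2,\dots,\lambda_n^2,\sigma_1^2,\dots,\sigma_n^2$ are mutually independent, each $\lambda_i^2$ having the proper prior density $\Pi(\lambda_i^2)=K(\lambda_i^2)^{-a-1}L(\lambda_i^2)$ on $(0,\infty)$, with $a>0$, $K>0$ the normalizing constant, and $L$ a slowly varying function (at infinity); (iv) each $\sigma_i^2$ has the inverse gamma prior density $\Pi(\sigma_i^2)=\frac{\beta^\alpha}{\Gamma(\alpha)}(\sigma_i^2)^{-\alpha-1}\exp(-\beta/\sigma_i^2)$ on $(0,\infty)$, $\alpha,\beta>0$. Standing assumption on $L$: it is nondecreasing and $0<L(u)\le M<\infty$ for all $u>0$. The shrinkage factor is $\kappa_i=(1+\lambda_i^2\tau^2)^{-1}$, and $\mathbb{E}(\cdot\mid X_i)$ denotes posterior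 expectation given $X_i$ under this model. *)

(* Defs.v *)
From mathcomp Require Import all_boot all_order all_algebra.
From mathcomp Require Import all_classical all_reals all_analysis.

Set Implicit Arguments.
Unset Strict Implicit.
Unset Printing Implicit Defensive.

Import Order.TTheory GRing.Theory Num.Theory.
Import numFieldNormedType.Exports.

Local Open Scope classical_set_scope.
Local Open Scope ring_scope.

Definition slowly_varying (R : realType) (L : R -> R) : Prop :=
  [/\ measurable_fun (`]0, +oo[ : set R) L,
      \forall t \near +oo, 0 < L t
    & forall c : R, 0 < c -> L (c * t) / L t @[t --> +oo] --> (1 : R)].

(* Euler's Gamma function at z > 0. *)
Definition Gamma_fun (R : realType) (z : R) : R :=
  \int[lebesgue_measure]_(t in `]0%R, +oo[) (t `^ (z - 1) * expR (- t)).

(* Densities on (0, +oo); their values at nonpositive points are never used. *)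
Definition local_prior_pdf (R : realType) (a K : R) (L : R -> R) (l : R) : R :=
  K * l `^ (- a - 1) * L l.

Definition inverse_gamma_pdf (R : realType) (alpha beta s : R) : R :=
  beta `^ alpha / Gamma_fun alpha * s `^ (- alpha - 1) * expR (- (beta / s)).

Definition shrinkage (R : realType) (tau l : R) : R := (1 + l * tau ^+ 2)^-1.

(* Joint density of one coordinate (X_i, theta_i, sigma_i^2, lambda_i^2) at
   (x, th, s, l): s and l are the values of the squares, while the library's
   normal_pdf takes the mean and the standard deviation.  The coordinates are
   independent, so the law given X_i only involves coordinate i. *)
Definition joint_pdf (R : realType) (tau : R) (pi_s pi_l : R -> R)
    (x th s l : R) : R :=
  normal_pdf th (Num.sqrt s) x * normal_pdf 0 (Num.sqrt (s * l * tau ^+ 2)) th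
  * pi_l l * pi_s s.

(* Integral of g against the joint density, in (theta_i, sigma_i^2, lambda_i^2),
   at X_i = x. *)
Definition joint_integral (R : realType) (tau : R) (pi_s pi_l : R -> R)
    (g : R -> R -> R -> R) (x : R) : \bar R :=
  (\int[lebesgue_measure]_(s in `]0%R, +oo[)
    \int[lebesgue_measure]_(l in `]0%R, +oo[)
      \int[lebesgue_measure]_th
        (g th s l * joint_pdf tau pi_s pi_l x th s l)%:E)%E.

(* E(g(theta_i, sigma_i^2, lambda_i^2) | X_i = x) by Bayes' formula; the
   denominator is the marginal density of X_i at x.  Meant for g >= 0. *)
Definition posterior_expectation (R : realType) (tau : R)
    (pi_s pi_l : R -> R) (g : R -> R -> R -> R) (x : R) : \bar R :=
  (joint_integral tau pi_s pi_l g x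
   / joint_integral tau pi_s pi_l (fun _ _ _ => 1%R) x)%E.

(* Main.v *)
Require Import Defs.
From mathcomp Require Import all_boot all_order all_algebra.
From mathcomp Require Import all_classical all_reals all_analysis.
From mathcomp Require Import measurable_realfun ring lra.
Import Order.TTheory GRing.Theory Num.Theory.
Import numFieldNormedType.Exports.
Local Open Scope classical_set_scope.
Local Open Scope ring_scope.

(* Integrating out theta leaves the density of N(0, s / kappa) at x.  Write
   w = x^2 / tau^2 and let c be the normalizing constant of the inverse gamma
   prior.  On {kappa <= u}, kappa is comparable to 1 / (l tau^2), so for fixed s
   the numerator is bounded by an inverse gamma kernel in l with shape a + 3/2
   and scale of order w / s; integrating it leaves an inverse gamma kernel in s
   with shape alpha - a - 1 > 0, hence N <= A c w^-a |x|^-3.  When |x| >= 1,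
   restricting the denominator to s in [1, 2] and l in [w, 2w], where L l >= L 1
   because w >= 1, gives D >= B c w^-a |x|^-1.  When |x| < 1, the trivial bound
   N <= D is enough.  The constant c is the same on both sides, so it may even
   vanish. *)

(** The integral of a nonnegative function is a supremum over the simple functions below it, and a
    larger integrand admits more of them. This form applies to iterated integrals without discussing
    how inner integrals depend on the outer variable. *)
Lemma ge0_le_integral_nonmeasurable d (T : measurableType d) (R : realType)
    (mu : {measure set T -> \bar R}) (D : set T) (f g : T -> \bar R) :
  (forall x, D x -> 0 <= f x)%E -> (forall x, D x -> f x <= g x)%E ->
  (\int[mu]_(x in D) f x <= \int[mu]_(x in D) g x)%E.
Proof.
move=> f0 fg.
have g0 x : D x -> (0 <= g x)%E by move=> Dx; exact: le_trans (f0 x Dx) (fg x Dx).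
rewrite integral_mkcond [leRHS]integral_mkcond !ge0_integralTE; last 2 first.
- by move=> x; exact: erestrict_ge0.
- by move=> x; exact: erestrict_ge0.
apply: le_ereal_sup => _ [h hf <-]; exists h => // x.
by apply: le_trans (hf x) _; exact: lee_restrict.
Qed.

(** * Power functions and integrals of inverse gamma kernels *)

Section kernel.
Context {R : realType}.
Notation mu := (@lebesgue_measure R).
Implicit Types p b q s x y : R.

Lemma gt0_powRD x p q : 0 < x -> x `^ (p + q) = x `^ p * x `^ q.
Proof. by move=> x0; rewrite powRD// (gt_eqF x0) implybT. Qed.

Lemma gt0_ler_powRN p y z : 0 <= p -> 0 < y -> y <= z ->
  z `^ (- p) <= y `^ (- p).
Proof.
move=> p0 y0 yz; have z0 := lt_le_trans y0 yz.
rewrite !powRN lef_pV2 ?posrE ?powR_gt0//.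
by rewrite ge0_ler_powR// nnegrE ltW.
Qed.

(** Raise [y / q <= 1 + y / q <= expR (y / q)] to the power [q]. *)
Lemma powR_le_expR q y : 0 < q -> 0 <= y -> y `^ q <= q `^ q * expR y.
Proof.
move=> q0 y0; rewrite -{1}(divfK (lt0r_neq0 q0) y) mulrC.
rewrite powRM ?divr_ge0// ?(ltW q0)//.
rewrite ler_wpM2l ?powR_ge0//.
have -> : expR y = expR (y / q) `^ q.
  by rewrite -expRM divfK ?gt_eqF.
rewrite ge0_ler_powR ?nnegrE ?divr_ge0 ?expR_ge0 ?(ltW q0)//.
by apply: le_trans (expR_ge1Dx _); rewrite lerDr.
Qed.

Lemma integral_powR_tail p b : 0 < p -> 0 < b ->
  (\int[mu]_(s in `[b, +oo[) (s `^ (- p - 1))%:E = (b `^ (- p) / p)%:E)%E.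
Proof.
move=> p0 b0.
have dpow s : 0 < s -> derivable (fun s => s `^ (- p)) s 1.
  by move=> s0; apply: derivable_powR; rewrite in_itv/= andbT.
rewrite (@ge0_continuous_FTC2y _ _ (fun s => - p^-1 * s `^ (- p)) _ 0).
- by rewrite -EFinB sub0r mulNr opprK mulrC.
- by move=> *; exact: powR_ge0.
- apply: derivable_within_continuous => x; rewrite in_itv/= andbT => bx.
  apply: derivable_powR; rewrite in_itv/= andbT; exact: lt_le_trans bx.
- rewrite -(mulr0 (- p^-1)); apply: cvgMr; apply/cvgr0Pnorm_lt => e e0.
  have ep0 : 0 < e `^ (- p^-1) by exact: powR_gt0.
  near=> s.
  have es : e `^ (- p^-1) < s by near: s; exact: nbhs_pinfty_gt.
  have s0 : 0 < s := lt_trans ep0 es.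
  rewrite ger0_norm ?powR_ge0// powRN invf_plt ?posrE ?powR_gt0//.
  have -> : e^-1 = (e `^ (- p^-1)) `^ p.
    by rewrite -powRrM mulNr mulVf ?gt_eqF// powR_inv1 // ltW.
  by rewrite gt0_ltr_powR// nnegrE ltW.
- move=> x bx; apply: derivableM; first exact: derivable_cst.
  by apply: dpow; exact: lt_trans bx.
- apply: cvgMr; apply: cvg_at_right_filter.
  have /derivable1_diffP/differentiable_continuous := dpow b b0; exact.
- move=> x; rewrite in_itv/= andbT => bx.
  have x0 : 0 < x by exact: lt_trans bx.
  rewrite derive1Ml; last exact: dpow.
  rewrite powR_derive1 ?in_itv/= ?x0// mulrA mulrNN mulVf ?mul1r//.
  by rewrite gt_eqF.
Unshelve. all: by end_near. Qed.

Lemma measurable_inverse_gamma_kernel p b :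
  measurable_fun (`]0, +oo[ : set R) (fun s : R => s `^ (- p - 1) * expR (- (b / s))).
Proof.
apply: (@eq_measurable_fun _ _ _ _ _
    (fun s => s `^ (- p - 1) * expR (- (b * s `^ (-1))))).
  by move=> s; rewrite inE/= in_itv/= andbT => s0; rewrite powR_inv1 ?ltW.
apply: (measurable_funS measurableT) => //.
apply: measurable_funM; first exact: measurable_powR.
apply: measurableT_comp => //; apply: measurableT_comp => //.
by apply: measurable_funM => //; exact: measurable_powR.
Qed.

(* Split at s = b: below it, exp(-b/s) <= q^q (s/b)^q with q = p + 1 makes the
   integrand at most q^q b^-q; above it, exp(-b/s) <= 1. *)
Lemma inverse_gamma_kernel_le p : 0 < p ->
  exists2 C : R, 0 < C & forall b : R, 0 < b ->
    (\int[mu]_(s in `]0%R, +oo[) (s `^ (- p - 1) * expR (- (b / s)))%:E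
     <= (C * b `^ (- p))%:E)%E.
Proof.
move=> p0; pose q := p + 1; have q0 : 0 < q by rewrite /q; lra.
exists (q `^ q + p^-1); first by rewrite addr_gt0 ?invr_gt0// powR_gt0.
move=> b b0.
have -> : `]0%R, +oo[%classic = `]0, b[ `|` `[b, +oo[ :> set R.
  by apply: itv_bndbnd_setU; rewrite bnd_simp ?ltW.
have sub : `]0, b[ `|` `[b, +oo[ `<=` (`]0%R, +oo[ : set R).
  move=> s /= []; rewrite !in_itv/= !andbT; [by case/andP|].
  exact: lt_le_trans.
rewrite (@ge0_integral_setU _ _ R mu)//=.
- rewrite mulrDl EFinD leeD//.
  (* The split-off factor [b] is the length of []0, b[]. *)
  + have -> : q `^ q * b `^ (- p) = q `^ q * b `^ (- p - 1) * b.
      by rewrite -mulrA -{3}(powRr1 (ltW b0)) -gt0_powRD// subrK.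
    apply: (@le_trans _ _ (\int[mu]_(s in `]0%R, b[) (q `^ q * b `^ (- p - 1))%:E)%E).
      apply: ge0_le_integral_nonmeasurable => s /=; rewrite in_itv/= => /andP[s0 sb].
        by rewrite lee_fin mulr_ge0 ?powR_ge0 ?expR_ge0.
      rewrite lee_fin.
      have -> : - p - 1 = - q by rewrite /q; ring.
      have H : b `^ q <= q `^ q * expR (b / s) * s `^ q.
        rewrite -{1}(divfK (lt0r_neq0 s0) b) powRM ?divr_ge0 ?(ltW b0) ?(ltW s0)//.
        apply: ler_wpM2r; first exact: powR_ge0.
        by apply: powR_le_expR => //; rewrite divr_ge0 ?ltW.
      rewrite expRN ler_pdivrMr ?expR_gt0// !powRN [leRHS]mulrAC.
      by rewrite ler_pdivlMr ?powR_gt0// mulrC ler_pdivrMr ?powR_gt0.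
    rewrite integral_cst//= lebesgue_measure_itv/= lte_fin b0 -EFinB -EFinM.
    by rewrite subr0.
  + rewrite mulrC -integral_powR_tail//.
    apply: ge0_le_integral_nonmeasurable => s /=; rewrite in_itv/= andbT => bs.
      by rewrite lee_fin mulr_ge0 ?powR_ge0 ?expR_ge0.
    rewrite lee_fin ler_piMr ?powR_ge0// -expR0 ler_expR oppr_le0.
    by rewrite divr_ge0 ?(ltW b0)// (le_trans (ltW b0)).
- apply: (measurable_funS _ sub) => //.
  by apply/measurable_EFinP; exact: measurable_inverse_gamma_kernel.
- by move=> s _; rewrite lee_fin mulr_ge0 ?powR_ge0 ?expR_ge0.
- apply/disj_setPS => s /= []; rewrite !in_itv/= !andbT => /andP[_ sb] bs.
  by move: (lt_le_trans sb bs); rewrite ltxx.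
Qed.

(** [C] is chosen before [k] and [b]; this uniformity is what later keeps the constants free of
    [tau] and [x]. *)
Lemma inverse_gamma_kernelZ_le p : 0 < p ->
  exists2 C : R, 0 < C & forall k b : R, 0 <= k -> 0 < b ->
    (\int[mu]_(s in `]0%R, +oo[)
       (k * (s `^ (- p - 1) * expR (- (b / s))))%:E
     <= (k * (C * b `^ (- p)))%:E)%E.
Proof.
move=> /inverse_gamma_kernel_le[C C0 HC]; exists C => // k b k0 b0.
under eq_integral do rewrite EFinM.
rewrite ge0_integralZl_EFin//=.
- by rewrite EFinM lee_wpmul2l ?lee_fin// HC.
- by move=> s _; rewrite lee_fin mulr_ge0 ?powR_ge0 ?expR_ge0.
- by apply/measurable_EFinP; exact: measurable_inverse_gamma_kernel.
Qed.

End kernel.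

(** * Gaussian densities in terms of the variance *)

Section normal.
Context {R : realType}.
Notation mu := (@lebesgue_measure R).

Lemma normal_pdf_sqrtE (m v x : R) : 0 < v ->
  normal_pdf m (Num.sqrt v) x
  = (Num.sqrt (v * pi *+ 2))^-1 * expR (- ((x - m) ^+ 2 / (2 * v))).
Proof.
move=> v0; rewrite normal_pdfE ?gt_eqF ?sqrtr_gt0//.
rewrite /normal_peak /normal_fun sqr_sqrtr ?(ltW v0)//.
by rewrite mulNr [2 * v]mulrC mulr_natr.
Qed.

(* Completing the square in th, with [t / (s + t) * x] the posterior mean. *)
Lemma normal_pdf_mul_conj (s t x th : R) : 0 < s -> 0 < t ->
  normal_pdf th (Num.sqrt s) x * normal_pdf 0 (Num.sqrt t) th
  = normal_pdf 0 (Num.sqrt (s + t)) x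
    * normal_pdf (t / (s + t) * x) (Num.sqrt (s * t / (s + t))) th.
Proof.
move=> s0 t0; have st0 : 0 < s + t by exact: addr_gt0.
have st' : 0 < s * t / (s + t) by rewrite divr_gt0// mulr_gt0.
rewrite !normal_pdf_sqrtE// [LHS]mulrACA [RHS]mulrACA -!expRD.
congr (_ * expR _).
  rewrite -!invfM -!sqrtrM ?mulrn_wge0 ?mulr_ge0 ?pi_ge0 ?(ltW s0) ?(ltW st0)//.
  congr (Num.sqrt _)^-1; field.
  by rewrite gt_eqF.
by field; rewrite !gt_eqF.
Qed.

(** Once the square is completed, the factor depending on [th] is a probability density and
    integrates to one. *)
Lemma integral_normal_pdf_conj (s t x : R) : 0 < s -> 0 < t ->
  (\int[mu]_th (normal_pdf th (Num.sqrt s) x * normal_pdf 0 (Num.sqrt t) th)%:E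
   = (normal_pdf 0 (Num.sqrt (s + t)) x)%:E)%E.
Proof.
move=> s0 t0.
under eq_integral do rewrite normal_pdf_mul_conj// EFinM.
rewrite ge0_integralZl_EFin//=.
- by rewrite integral_normal_pdf mule1.
- by move=> th _; rewrite lee_fin normal_pdf_ge0.
- by apply/measurable_EFinP; exact: measurable_normal_pdf.
- exact: normal_pdf_ge0.
Qed.

(** The lower bound on the variance controls the peak, the upper bound the exponential; the factor
    [2 * pi >= 1] is dropped. *)
Lemma normal_pdf_le (v v1 v2 x : R) : 0 < v1 -> v1 <= v <= v2 ->
  normal_pdf 0 (Num.sqrt v) x
    <= (Num.sqrt v1)^-1 * expR (- (x ^+ 2 / (2 * v2))).
Proof.
move=> v10 /andP[v1v vv2].
have v0 : 0 < v by exact: lt_le_trans v1v.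
rewrite normal_pdf_sqrtE// subr0 ler_pM ?invr_ge0 ?sqrtr_ge0 ?expR_ge0//.
  rewrite lef_pV2 ?posrE ?sqrtr_gt0 ?mulrn_wgt0 ?mulr_gt0 ?pi_gt0//.
  rewrite ler_sqrt ?mulrn_wge0 ?mulr_ge0 ?pi_ge0 ?(ltW v0)//.
  apply: (le_trans v1v); rewrite -mulrnAr ler_peMr ?(ltW v0)//.
  have := pi_ge2 R; lra.
have v20 : 0 < v2 by exact: lt_le_trans vv2.
rewrite ler_expR lerN2 ler_wpM2l ?sqr_ge0// lef_pV2 ?posrE ?mulr_gt0//.
by rewrite ler_wpM2l.
Qed.

End normal.

(** The bound survives the conventions of extended division: [D = 0] forces [N = 0], whose product
    with anything is 0, and [D = +oo] has inverse 0. A negative [D] makes the quotient at most 0. *)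
Lemma ge0_lee_div (R : realType) (N D : \bar R) (k : R) :
  (0 <= N)%E -> 0 <= k -> (N <= k%:E * D)%E -> (N / D <= k%:E)%E.
Proof.
move=> N0 k0; case: inveP => [|||r r0].
- rewrite mule0 => NE; have -> : N = 0%E by apply/le_anti; rewrite NE N0.
  by rewrite mul0e lee_fin.
- by rewrite mule0 lee_fin.
- move=> NE; have : (k%:E * -oo <= 0 :> \bar R)%E by rewrite mule_ge0_le0.
  move=> /(le_trans NE) {}NE; have -> : N = 0%E by apply/le_anti; rewrite NE N0.
  by rewrite mul0e lee_fin.
- case: N N0 => [n| |]//= n0; rewrite -!EFinM !lee_fin => nkr.
  have [r_gt0|r_le0] := ltP 0 r; first by rewrite ler_pdivrMr.
  apply: le_trans k0; rewrite mulr_ge0_le0// invr_le0//.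
Qed.

Section integral_itv0y.
Context {R : realType}.
Notation mu := (@lebesgue_measure R).

Lemma cst_le_integral_itv0y (f : R -> \bar R) (k p q : R) :
  0 < p -> p <= q -> 0 <= k ->
  (forall s, (0 < s)%R -> (0 <= f s)%E) ->
  (forall s, (p <= s <= q)%R -> (k%:E <= f s)%E) ->
  ((k * (q - p))%:E <= \int[mu]_(s in `]0%R, +oo[) f s)%E.
Proof.
move=> p0 pq k0 f0 fk.
have -> : (k * (q - p))%:E
    = (\int[mu]_(s in `]0%R, +oo[) ((cst k%:E) \_ `[p, q]) s)%E.
  rewrite -integral_mkcondr setIidr; last first.
    by move=> s /=; rewrite !in_itv/= andbT => /andP[ps _]; exact: lt_le_trans ps.
  rewrite integral_cst//= lebesgue_measure_itv/= lte_fin.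
  move: pq; rewrite le_eqVlt => /predU1P[<-|->].
    by rewrite ltxx subrr mulr0 mule0.
  by rewrite -EFinB -EFinM.
apply: ge0_le_integral_nonmeasurable => s /=; rewrite in_itv/= andbT => s0.
  by apply: erestrict_ge0 => *; rewrite lee_fin.
rewrite patchE; case: ifPn => [|_]; last exact: f0.
by rewrite inE/= in_itv/=; exact: fk.
Qed.

End integral_itv0y.

(** * Integrating the mean out of the joint density *)

Section joint.
Context {R : realType}.
Notation mu := (@lebesgue_measure R).
Variables (tau : R) (pi_s pi_l : R -> R).
Hypothesis tau_gt0 : 0 < tau.
Hypothesis pi_s_ge0 : forall s, 0 < s -> 0 <= pi_s s.
Hypothesis pi_l_ge0 : forall l, 0 < l -> 0 <= pi_l l.

(** What remains of the joint density once [th] is integrated out: the noise variance [s] and the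
    prior variance [s * l * tau ^+ 2] add up to [s] over the shrinkage factor. *)
Definition marginal_pdf (x s l : R) : R :=
  normal_pdf 0 (Num.sqrt (s * (1 + l * tau ^+ 2))) x * pi_l l * pi_s s.

Lemma marginal_pdf_ge0 x s l : 0 < s -> 0 < l -> 0 <= marginal_pdf x s l.
Proof.
by move=> s0 l0; rewrite !mulr_ge0 ?normal_pdf_ge0 ?pi_s_ge0 ?pi_l_ge0.
Qed.

Lemma integral_joint_pdf (k x s l : R) : 0 <= k -> 0 < s -> 0 < l ->
  (\int[mu]_th (k * joint_pdf tau pi_s pi_l x th s l)%:E
   = (k * marginal_pdf x s l)%:E)%E.
Proof.
move=> k0 s0 l0.
have slt0 : 0 < s * l * tau ^+ 2 by rewrite !mulr_gt0 ?exprn_gt0.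
transitivity (\int[mu]_th ((k * pi_l l * pi_s s)%:E
    * (normal_pdf th (Num.sqrt s) x
       * normal_pdf 0 (Num.sqrt (s * l * tau ^+ 2)) th)%:E))%E.
  by apply: eq_integral => th _; rewrite -EFinM /joint_pdf; congr EFin; ring.
rewrite ge0_integralZl_EFin//=.
- rewrite integral_normal_pdf_conj// -EFinM /marginal_pdf.
  have -> : s + s * l * tau ^+ 2 = s * (1 + l * tau ^+ 2) by ring.
  by congr EFin; ring.
- by move=> th _; rewrite lee_fin mulr_ge0 ?normal_pdf_ge0.
- under eq_fun do rewrite normal_pdf_mul_conj//.
  apply/measurable_EFinP; apply: measurable_funM => //.
  exact: measurable_normal_pdf.
- by rewrite !mulr_ge0 ?pi_s_ge0 ?pi_l_ge0.
Qed.

(** Used with [g] the truncated shrinkage factor for the numerator and with [g = 1] for the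
    denominator. *)
Lemma joint_integralE (g : R -> R) (x : R) :
  (forall l, 0 < l -> 0 <= g l) ->
  joint_integral tau pi_s pi_l (fun _ _ l => g l) x
  = (\int[mu]_(s in `]0%R, +oo[) \int[mu]_(l in `]0%R, +oo[)
       (g l * marginal_pdf x s l)%:E)%E.
Proof.
move=> g0; apply: eq_integral => s; rewrite inE/= in_itv/= andbT => s0.
apply: eq_integral => l; rewrite inE/= in_itv/= andbT => l0.
by rewrite integral_joint_pdf ?g0.
Qed.

End joint.

(** * Upper bound for the numerator, lower bound for the denominator *)

Section bounds.
Context {R : realType}.
Notation mu := (@lebesgue_measure R).
Variables (a K alpha beta M : R) (L : R -> R).
Hypotheses (a_gt0 : 0 < a) (K_gt0 : 0 < K) (beta_gt0 : 0 < beta).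
Hypothesis L_bounded : forall t : R, 0 < t -> 0 < L t <= M.
Hypothesis alpha_gt : a + 1 < alpha.

Local Notation c := (beta `^ alpha / Gamma_fun alpha).
Local Notation pi_s := (inverse_gamma_pdf alpha beta).
Local Notation pi_l := (local_prior_pdf a K L).

Lemma Gamma_fun_ge0 (z : R) : 0 <= Gamma_fun z.
Proof.
by apply: Rintegral_ge0 => t _; rewrite mulr_ge0 ?powR_ge0 ?expR_ge0.
Qed.

Lemma inverse_gamma_pdf_ge0 s : 0 <= inverse_gamma_pdf alpha beta s.
Proof.
by rewrite !mulr_ge0 ?invr_ge0 ?powR_ge0 ?expR_ge0 ?Gamma_fun_ge0.
Qed.

Lemma local_prior_pdf_ge0 l : 0 < l -> 0 <= local_prior_pdf a K L l.
Proof.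
by move=> /L_bounded/andP[/ltW ? _]; rewrite !mulr_ge0 ?powR_ge0 ?(ltW K_gt0).
Qed.

Lemma shrinkage_gt0 (tau l : R) : 0 <= l -> 0 < shrinkage tau l.
Proof. by move=> l0; rewrite invr_gt0 ltr_pwDl// mulr_ge0 ?sqr_ge0. Qed.

(** Where the shrinkage factor exceeds [u] the left side is 0. Elsewhere the factor is at most
    [(l * tau ^+ 2)^-1], [L l] is at most [M], and the variance is trapped between two multiples of
    [s * l * tau ^+ 2]. *)
Lemma shrinkage_marginal_le (u tau x s l : R) :
  0 < u < 1 -> 0 < tau -> 0 < s -> 0 < l ->
  shrinkage tau l * (shrinkage tau l <= u)%R%:R
    * marginal_pdf tau (inverse_gamma_pdf alpha beta) (local_prior_pdf a K L) x s l
  <= K * M / (tau ^+ 3 * Num.sqrt s) * inverse_gamma_pdf alpha beta s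
     * (l `^ (- (a + 3 / 2) - 1)
        * expR (- ((1 - u) / 2 * (x ^+ 2 / tau ^+ 2) * s^-1 / l))).
Proof.
move=> /andP[u0 u1] t0 s0 l0.
have igs := inverse_gamma_pdf_ge0 s.
have /andP[Ll0 LM] := L_bounded l l0.
have M0 : 0 < M by exact: lt_le_trans LM.
have lt0 : 0 < l * tau ^+ 2 by rewrite mulr_gt0 ?exprn_gt0.
have slt0 : 0 < s * (l * tau ^+ 2) by rewrite mulr_gt0.
have u10 : 0 < 1 - u by rewrite subr_gt0.
case: (boolP (shrinkage tau l <= u)) => [ku|_]; last first.
  rewrite mulr0 mul0r; apply: mulr_ge0; last first.
    by rewrite mulr_ge0 ?powR_ge0 ?expR_ge0.
  apply: mulr_ge0 => //.
  by rewrite divr_ge0 ?mulr_ge0 ?exprn_ge0 ?sqrtr_ge0 ?(ltW K_gt0) ?(ltW M0) ?(ltW t0).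
rewrite mulr1 /marginal_pdf /local_prior_pdf.
have Hk : shrinkage tau l <= (l * tau ^+ 2)^-1.
  rewrite lef_pV2 ?posrE// ?lerDr//; first by rewrite addr_gt0.
(* The condition [ku] says [1 <= u * (1 + l * tau ^+ 2)], that is, [(1 - u) * (1 + l * tau ^+ 2) <=
   l * tau ^+ 2]. *)
have v12 : s * (l * tau ^+ 2) <= s * (1 + l * tau ^+ 2)
           <= s * (l * tau ^+ 2) / (1 - u).
  rewrite ler_pM2l// lerDr ler01/= -mulrA ler_pM2l// ler_pdivlMr//.
  move: ku; rewrite /shrinkage -ler_pV2 ?inE ?unitfE ?gt_eqF ?invr_gt0 ?addr_gt0//.
  rewrite invrK => ku.
  have : 1 <= (1 + l * tau ^+ 2) * u by rewrite -ler_pdivrMr// div1r.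
  lra.
have Hn := @normal_pdf_le _ _ _ _ x slt0 v12.
have Hp : K * l `^ (- a - 1) * L l <= K * l `^ (- a - 1) * M.
  by rewrite ler_wpM2l// mulr_ge0 ?powR_ge0 ?(ltW K_gt0).
have H1 : shrinkage tau l * (normal_pdf 0 (Num.sqrt (s * (1 + l * tau ^+ 2))) x *
    (K * l `^ (- a - 1) * L l) * inverse_gamma_pdf alpha beta s)
  <= (l * tau ^+ 2)^-1 * ((Num.sqrt (s * (l * tau ^+ 2)))^-1 *
       expR (- (x ^+ 2 / (2 * (s * (l * tau ^+ 2) / (1 - u))))) *
       (K * l `^ (- a - 1) * M) * inverse_gamma_pdf alpha beta s).
  have P0 : 0 <= K * l `^ (- a - 1) * L l.
    by rewrite !mulr_ge0 ?powR_ge0 ?(ltW K_gt0) ?(ltW Ll0).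
  have N0 := normal_pdf_ge0 0 (Num.sqrt (s * (1 + l * tau ^+ 2))) x.
  apply: ler_pM => //; first by rewrite ltW// shrinkage_gt0// ltW.
    by apply: mulr_ge0 => //; exact: mulr_ge0.
  by apply: ler_wpM2r => //; apply: ler_pM.
apply: (le_trans H1); rewrite le_eqVlt; apply/orP; left; apply/eqP.
have -> : x ^+ 2 / (2 * (s * (l * tau ^+ 2) / (1 - u)))
   = (1 - u) / 2 * (x ^+ 2 / tau ^+ 2) * s^-1 / l.
  by field; rewrite !gt_eqF.
(* The prior, the shrinkage factor and the Gaussian peak contribute the exponents [- a - 1], [-1]
   and [- 1/2]. *)
have -> : l `^ (- (a + 3 / 2) - 1) = l `^ (- a - 1) * (l^-1 * (Num.sqrt l)^-1).
  rewrite -(powR12_sqrt (ltW l0)) -powRN -(powR_inv1 (ltW l0)) -!gt0_powRD//.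
  by congr (_ `^ _); field.
have -> : Num.sqrt (s * (l * tau ^+ 2)) = Num.sqrt s * (Num.sqrt l * tau).
  by rewrite (sqrtrM _ (ltW s0)) (sqrtrM _ (ltW l0)) sqrtr_sqr gtr0_norm.
have ss : Num.sqrt s != 0 by rewrite gt_eqF ?sqrtr_gt0.
have sl : Num.sqrt l != 0 by rewrite gt_eqF ?sqrtr_gt0.
by field; rewrite ss sl !gt_eqF.
Qed.

(** Two kernel integrals in succession: over [l] with shape [a + 3 / 2], then over [s] with shape
    [alpha - a - 1], positive by [alpha_gt]. *)
Lemma joint_integral_shrinkage_le (u : R) : 0 < u < 1 ->
  exists2 A : R, 0 < A & forall tau x : R, 0 < tau -> x != 0 ->
    (joint_integral tau pi_s pi_l
       (fun _ _ l => shrinkage tau l * (shrinkage tau l <= u)%R%:R)%R x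
     <= (A * c * (x ^+ 2 / tau ^+ 2) `^ (- a) / `|x| ^+ 3)%:E)%E.
Proof.
move=> u01; have /andP[u0 u1] := u01.
have M0 : 0 < M by have /andP[+ +] := L_bounded 1 ltr01; exact: lt_le_trans.
have p1 : 0 < a + 3 / 2 by rewrite addr_gt0// divr_gt0.
have p2 : 0 < alpha - a - 1 by rewrite -addrA -opprD subr_gt0.
have [C1 C10 HC1] := inverse_gamma_kernelZ_le _ p1.
have [C2 C20 HC2] := inverse_gamma_kernelZ_le _ p2.
have u20 : 0 < (1 - u) / 2 by rewrite divr_gt0// subr_gt0.
(* The first line is what the [l] integral leaves besides powers of [w] and [s]; the second is the
   [s] integral at scale [beta]. *)
exists (K * M * C1 * ((1 - u) / 2) `^ (- (a + 3 / 2))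
        * (C2 * beta `^ (- (alpha - a - 1)))).
  by rewrite !mulr_gt0// powR_gt0.
move=> tau x t0 x0.
have ax : 0 < `|x| by rewrite normr_gt0.
have x20 : 0 < x ^+ 2 by rewrite exprn_even_gt0.
have w0 : 0 < x ^+ 2 / tau ^+ 2 by apply: divr_gt0 => //; exact: exprn_gt0.
have c0 : 0 <= c by rewrite divr_ge0 ?powR_ge0 ?Gamma_fun_ge0.
set w := x ^+ 2 / tau ^+ 2 in w0 *.
have g0 l : 0 < l -> 0 <= shrinkage tau l * (shrinkage tau l <= u)%R%:R.
  by move=> l0; rewrite mulr_ge0// ltW// shrinkage_gt0// ltW.
rewrite joint_integralE//; last 2 first.
- by move=> s _; exact: inverse_gamma_pdf_ge0.
- by move=> l; exact: local_prior_pdf_ge0.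
pose k := K * M * C1 * ((1 - u) / 2) `^ (- (a + 3 / 2)) * c
          * w `^ (- a) / `|x| ^+ 3.
have k0 : 0 <= k.
  rewrite /k divr_ge0 ?exprn_ge0// mulr_ge0 ?powR_ge0// mulr_ge0//.
  by rewrite !mulr_ge0 ?powR_ge0 ?(ltW K_gt0) ?(ltW M0) ?(ltW C10).
have Hs s : 0 < s ->
  (\int[mu]_(l in `]0%R, +oo[)
     (shrinkage tau l * (shrinkage tau l <= u)%R%:R
      * marginal_pdf tau pi_s pi_l x s l)%:E
   <= (k * (s `^ (- (alpha - a - 1) - 1) * expR (- (beta / s))))%:E)%E.
  move=> s0.
  have igs := inverse_gamma_pdf_ge0 s.
  pose k1 := K * M / (tau ^+ 3 * Num.sqrt s) * pi_s s.
  have k10 : 0 <= k1.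
    apply: mulr_ge0 => //.
    by rewrite divr_ge0 ?mulr_ge0 ?exprn_ge0 ?sqrtr_ge0 ?(ltW K_gt0) ?(ltW M0)
      ?(ltW t0).
  have b0 : 0 < (1 - u) / 2 * w * s^-1.
    by rewrite divr_gt0// mulr_gt0.
  apply: (@le_trans _ _ (k1 * (C1 * ((1 - u) / 2 * w * s^-1) `^ (- (a + 3 / 2))))%:E).
    apply: le_trans (HC1 _ _ k10 b0).
    apply: ge0_le_integral_nonmeasurable => l /=; rewrite in_itv/= andbT => l0.
      rewrite lee_fin mulr_ge0 ?g0// marginal_pdf_ge0//.
        by move=> ? _; exact: inverse_gamma_pdf_ge0.
      by move=> ?; exact: local_prior_pdf_ge0.
    by rewrite lee_fin; exact: shrinkage_marginal_le.
  rewrite lee_fin le_eqVlt; apply/orP; left; apply/eqP.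
  (* Since [w] to the power [- 1/2] is [tau / |x|], the power [- 3/2] of [w] cancels [tau ^+ 3] and
     leaves the cube of [|x|] below. *)
  have w' : w `^ (- (a + 3 / 2)) = w `^ (- a) * (tau / `|x|) ^+ 3.
    have -> : - (a + 3 / 2) = - a + - (2^-1 * 3%:R) by field.
    rewrite gt0_powRD// (powRN w (_ * _)) powRrM powR12_sqrt ?(ltW w0)//.
    rewrite powR_mulrn ?sqrtr_ge0//.
    rewrite /w -expr_div_n sqrtr_sqr normrM (@gtr0_norm _ tau^-1) ?invr_gt0//.
    by rewrite -exprVn invf_div.
  (* The powers of [s] come from its prior, from the scale of the [l] kernel and from the Gaussian
     peak. *)
  have s' : s `^ (- (alpha - a - 1) - 1)
      = s `^ (- alpha - 1) * (s^-1 `^ (- (a + 3 / 2)) / Num.sqrt s).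
    rewrite -(powR12_sqrt (ltW s0)) -powRN -(powR_inv1 (ltW s0)) -powRrM.
    by rewrite -!gt0_powRD//; congr (_ `^ _); field.
  have b' q : ((1 - u) / 2 * w * s^-1) `^ q
      = ((1 - u) / 2) `^ q * w `^ q * s^-1 `^ q.
    have uw0 : 0 <= (1 - u) / 2 * w by exact/ltW/mulr_gt0.
    have si0 : 0 <= s^-1 by rewrite invr_ge0 ltW.
    by rewrite (powRM _ uw0 si0) (powRM _ (ltW u20) (ltW w0)).
  rewrite /k1 /k /inverse_gamma_pdf b' w' s'.
  have ss : Num.sqrt s != 0 by rewrite gt_eqF ?sqrtr_gt0.
  rewrite expr_div_n.
  (* With [c] opaque, [field] does not ask for [Gamma_fun alpha] to be nonzero. *)
  move: c => r; field.
  by rewrite ss !gt_eqF.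
apply: (@le_trans _ _ (k * (C2 * beta `^ (- (alpha - a - 1))))%:E).
  apply: le_trans (HC2 _ _ k0 beta_gt0).
  apply: ge0_le_integral_nonmeasurable => s /=; rewrite in_itv/= andbT => s0.
    apply: integral_ge0 => l /=; rewrite in_itv/= andbT => l0.
    rewrite lee_fin mulr_ge0 ?g0// marginal_pdf_ge0//.
      by move=> ? _; exact: inverse_gamma_pdf_ge0.
    by move=> ?; exact: local_prior_pdf_ge0.
  exact: Hs.
by rewrite lee_fin le_eqVlt; apply/orP; left; apply/eqP; rewrite /k; ring.
Qed.

(** On the rectangle [1 <= s <= 2], [w <= l <= 2 * w] the variance lies between [x ^+ 2] and
    [6 * x ^+ 2], so the Gaussian factor is of order [1 / |x|]. The area [w] of the rectangle turns
    the prior's [w]^ (- a - 1)[into]w [^ (- a)]. *)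
Lemma joint_integral_ge (alpha_gt0 : 0 < alpha)
    (L_nondecreasing : forall t1 t2 : R, 0 < t1 -> t1 <= t2 -> L t1 <= L t2) :
  exists2 B : R, 0 < B & forall tau x : R, 0 < tau < 1 -> 1 <= `|x| ->
    ((B * c * (x ^+ 2 / tau ^+ 2) `^ (- a) / `|x|)%:E
     <= joint_integral tau pi_s pi_l (fun _ _ _ => 1%R) x)%E.
Proof.
have /andP[L10 _] := L_bounded 1 ltr01.
(* Worst case of each factor on the rectangle: variance [6 * x ^+ 2] in the peak and [x ^+ 2] in the
   exponential, [l = 2 * w] in the power and 1 in [L], [s = 2] in the power and [s = 1] in the last
   exponential. *)
exists ((Num.sqrt (12 * pi))^-1 * expR (- 2^-1) * K * 2 `^ (- a - 1) * L 1
        * 2 `^ (- alpha - 1) * expR (- beta)).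
  by rewrite !mulr_gt0 ?invr_gt0 ?sqrtr_gt0 ?powR_gt0 ?expR_gt0 ?mulr_gt0 ?pi_gt0.
move=> tau x /andP[t0 t1] x1.
have ax : 0 < `|x| by exact: lt_le_trans x1.
have x21 : 1 <= x ^+ 2 by rewrite -real_normK ?num_real// exprn_ege1.
have x20 : 0 < x ^+ 2 by exact: lt_le_trans x21.
have t20 : 0 < tau ^+ 2 by exact: exprn_gt0.
have w1 : 1 <= x ^+ 2 / tau ^+ 2.
  by rewrite ler_pdivlMr// mul1r (le_trans _ x21)// exprn_ile1 ?(ltW t0) ?(ltW t1).
have wt : x ^+ 2 / tau ^+ 2 * tau ^+ 2 = x ^+ 2 by rewrite divfK// gt_eqF.
set w := x ^+ 2 / tau ^+ 2 in w1 wt *.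
have w0 : 0 < w by exact: lt_le_trans w1.
have c0 : 0 <= c by rewrite divr_ge0 ?powR_ge0 ?Gamma_fun_ge0.
rewrite (joint_integralE _ _ _ t0 _ _ (fun=> 1))//; last 2 first.
- by move=> s _; exact: inverse_gamma_pdf_ge0.
- by move=> l; exact: local_prior_pdf_ge0.
under eq_integral do under eq_integral do rewrite mul1r.
have mge0 s l : 0 < s -> 0 < l -> 0 <= marginal_pdf tau pi_s pi_l x s l.
  apply: marginal_pdf_ge0 => [? _|?]; first exact: inverse_gamma_pdf_ge0.
  exact: local_prior_pdf_ge0.
pose k := (Num.sqrt (12 * pi) * `|x|)^-1 * expR (- 2^-1)
  * (K * (2 * w) `^ (- a - 1) * L 1)
  * (c * 2 `^ (- alpha - 1) * expR (- beta)).
have K0 := ltW K_gt0.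
have k0 : 0 <= k.
  rewrite /k mulr_ge0//; last first.
    by rewrite !mulr_ge0 ?invr_ge0 ?powR_ge0 ?expR_ge0 ?Gamma_fun_ge0.
  by rewrite !mulr_ge0 ?powR_ge0 ?expR_ge0 ?invr_ge0 ?mulr_ge0 ?sqrtr_ge0 ?(ltW L10).
have km s l : 1 <= s <= 2 -> w <= l <= 2 * w ->
    k <= marginal_pdf tau pi_s pi_l x s l.
  move=> /andP[s1 s2] /andP[wl l2w].
  have s0 : 0 < s by exact: lt_le_trans s1.
  have l0 : 0 < l by exact: lt_le_trans wl.
  have xl : x ^+ 2 <= l * tau ^+ 2 by rewrite -wt ler_pM2r.
  have lx : l * tau ^+ 2 <= 2 * x ^+ 2 by rewrite -wt mulrA ler_pM2r.
  set v := 1 + l * tau ^+ 2.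
  have v0 : 0 < v by rewrite /v addr_gt0// mulr_gt0.
  (* As [1 <= x ^+ 2], the bounds on [l * tau ^+ 2] give [x ^+ 2 <= v <= 3 * x ^+ 2]. *)
  have xv : x ^+ 2 <= s * v.
    rewrite (@le_trans _ _ v)//; first by rewrite /v; lra.
    by rewrite ler_peMl// ltW.
  have vx : s * v <= 6 * x ^+ 2.
    rewrite (@le_trans _ _ (2 * v))//; first by rewrite ler_pM2r.
    by rewrite /v; lra.
  have sv0 : 0 < s * v by rewrite mulr_gt0.
  rewrite /k /marginal_pdf -/v; apply: ler_pM.
  - by rewrite !mulr_ge0 ?powR_ge0 ?expR_ge0 ?invr_ge0 ?mulr_ge0 ?sqrtr_ge0 ?(ltW L10).
  - by rewrite !mulr_ge0 ?invr_ge0 ?powR_ge0 ?expR_ge0 ?Gamma_fun_ge0.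
  - apply: ler_pM.
    + by rewrite !mulr_ge0 ?expR_ge0 ?invr_ge0 ?mulr_ge0 ?sqrtr_ge0.
    + by rewrite !mulr_ge0 ?powR_ge0 ?(ltW L10).
    + rewrite normal_pdf_sqrtE// subr0; apply: ler_pM.
      * by rewrite invr_ge0 mulr_ge0 ?sqrtr_ge0.
      * exact: expR_ge0.
      * rewrite lef_pV2 ?posrE ?mulr_gt0 ?sqrtr_gt0 ?mulrn_wgt0 ?mulr_gt0 ?pi_gt0//.
        rewrite -sqrtr_sqr -sqrtrM ?mulr_ge0 ?pi_ge0//.
        rewrite ler_sqrt; last by rewrite (mulr_ge0 _ (ltW x20))// mulr_ge0// pi_ge0.
        have -> : 12 * pi * x ^+ 2 = 6 * x ^+ 2 * pi *+ 2 :> R by ring.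
        by rewrite lerMn2r/= ler_pM2r ?pi_gt0.
      * rewrite ler_expR lerN2 ler_pdivrMr ?mulr_gt0// mulKf//.
    + rewrite /local_prior_pdf; apply: ler_pM.
      * by rewrite mulr_ge0 ?powR_ge0.
      * exact: ltW.
      * rewrite ler_pM2l// -opprD gt0_ler_powRN// addr_ge0// ltW//.
      * by rewrite L_nondecreasing// (le_trans w1).
  - rewrite /inverse_gamma_pdf; apply: ler_pM.
    + by rewrite mulr_ge0 ?powR_ge0.
    + exact: expR_ge0.
    + by rewrite ler_wpM2l// -opprD gt0_ler_powRN// addr_ge0// ltW.
    + by rewrite ler_expR lerN2 ler_pdivrMr// ler_peMr// ltW.
have w2w : w <= 2 * w by rewrite ler_peMl ?ltW ?ltr1n.
(* The side lengths are displayed so that the constant bound applies first in [s], then in [l]. *)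
have kE : (k * w)%:E = ((k * (2 * w - w)) * (2 - 1))%:E by congr EFin; ring.
apply: (@le_trans _ _ (k * w)%:E); last first.
  rewrite kE; apply: cst_le_integral_itv0y => //.
  - by rewrite ler1n.
  - by rewrite mulr_ge0// subr_ge0.
  - move=> s s0; apply: integral_ge0 => l /=; rewrite in_itv/= andbT => l0.
    by rewrite lee_fin mge0.
  - move=> s s12; have s0 : 0 < s by have /andP[+ _] := s12; exact: lt_le_trans.
    apply: cst_le_integral_itv0y => //.
      by move=> l l0; rewrite lee_fin mge0.
    by move=> l l12; rewrite lee_fin km.
rewrite lee_fin le_eqVlt; apply/orP; left; apply/eqP.
rewrite /k powRM ?(ltW w0)//.
have -> : w `^ (- a) = w `^ (- a - 1) * w.
  by rewrite -{3}(powRr1 (ltW w0)) -gt0_powRD// subrK.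
have sp : Num.sqrt (12 * pi) != 0 :> R by rewrite gt_eqF// sqrtr_gt0 mulr_gt0// pi_gt0.
by move: c => r; field; rewrite sp gt_eqF.
Qed.

End bounds.

(** * Comparison of the two bounds, by cases on the size of [|x|] *)

Theorem lemma5p3 (R : realType) (a K alpha beta M : R) (L : R -> R)
  (a_gt0 : 0 < a) (K_gt0 : 0 < K) (alpha_gt0 : 0 < alpha) (beta_gt0 : 0 < beta)
  (L_slow : slowly_varying L)
  (L_nondecreasing : forall t1 t2 : R, 0 < t1 -> t1 <= t2 -> L t1 <= L t2)
  (L_bounded : forall t : R, 0 < t -> 0 < L t <= M)
  (K_normalizing : (\int[lebesgue_measure]_(l in `]0%R, +oo[)
     (local_prior_pdf a K L l)%:E = 1)%E)
  (alpha_range : a + 1 < alpha < a + 2)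
  (u : R) (u_range : 0 < u < 1) :
  exists C : R, 0 < C /\
    forall tau : R, 0 < tau < 1 -> forall x : R, x != 0 ->
      (posterior_expectation tau
         (inverse_gamma_pdf alpha beta) (local_prior_pdf a K L)
         (fun _ _ l => shrinkage tau l * (shrinkage tau l <= u)%R%:R)%R x
       <= (C / x ^+ 2)%:E)%E.
Proof.
have /andP[alpha_gt _] := alpha_range.
have [A A0 numer] := joint_integral_shrinkage_le
  _ _ _ _ _ _ a_gt0 K_gt0 beta_gt0 L_bounded alpha_gt _ u_range.
have [B B0 denom] := joint_integral_ge
  _ _ _ beta _ _ a_gt0 K_gt0 beta_gt0 L_bounded alpha_gt0 L_nondecreasing.
have AB0 : 0 < A / B by exact: divr_gt0.
(* [A / B] serves the case [|x| >= 1], the summand 1 the case [|x| < 1]. *)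
exists (1 + A / B); split; first by rewrite addr_gt0.
move=> tau t01 x x0; have /andP[t0 t1] := t01.
have ax : 0 < `|x| by rewrite normr_gt0.
have x20 : 0 < x ^+ 2 by rewrite exprn_even_gt0.
have ig0 s : 0 < s -> 0 <= inverse_gamma_pdf alpha beta s.
  by move=> _; exact: inverse_gamma_pdf_ge0.
have lp0 l : 0 < l -> 0 <= local_prior_pdf a K L l.
  exact: (local_prior_pdf_ge0 _ _ _ _ K_gt0 L_bounded).
have g0 l : 0 < l -> 0 <= shrinkage tau l * (shrinkage tau l <= u)%R%:R.
  by move=> l0; rewrite mulr_ge0// ltW// shrinkage_gt0// ltW.
have C0 : 0 <= (1 + A / B) / x ^+ 2 by rewrite divr_ge0 ?addr_ge0// ltW.
apply: ge0_lee_div => //.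
  rewrite joint_integralE//.
  apply: integral_ge0 => s /=; rewrite in_itv/= andbT => s0.
  apply: integral_ge0 => l /=; rewrite in_itv/= andbT => l0.
  by rewrite lee_fin mulr_ge0 ?g0// marginal_pdf_ge0.
have [x1|x1] := leP 1 `|x|.
  apply: le_trans (numer tau x t0 x0) _.
  apply: le_trans (lee_wpmul2l _ (denom tau x t01 x1)); last by rewrite lee_fin.
  have c0 : 0 <= beta `^ alpha / Gamma_fun alpha.
    by rewrite divr_ge0 ?powR_ge0 ?Gamma_fun_ge0.
  move: c0; set c := _ / _; set W := _ `^ (- a) => c0.
  have W0 : 0 <= W by exact: powR_ge0.
  rewrite -EFinM lee_fin -[x ^+ 2]real_normK ?num_real//.
  (* The common factor [c * W] stays on the right, so only [|x| ^+ 2] is left in the ratio. *)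
  have -> : A * c * W / `|x| ^+ 3 = A / B / `|x| ^+ 2 * (B * c * W / `|x|).
    by field; rewrite !gt_eqF.
  rewrite ler_wpM2r//; first by rewrite divr_ge0// mulr_ge0// mulr_ge0// ltW.
  by rewrite ler_wpM2r ?invr_ge0 ?exprn_ge0// lerDr.
(* For [|x| < 1] the truncated shrinkage factor is at most 1, so the numerator is at most the
   denominator, while the target constant is at least 1. *)
apply: (@le_trans _ _ (joint_integral tau (inverse_gamma_pdf alpha beta)
    (local_prior_pdf a K L) (fun _ _ _ => 1) x)).
  rewrite (joint_integralE _ _ _ t0 ig0 lp0 (fun=> 1))// joint_integralE//.
  apply: ge0_le_integral_nonmeasurable => s /=; rewrite in_itv/= andbT => s0.
    apply: integral_ge0 => l /=; rewrite in_itv/= andbT => l0.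
    by rewrite lee_fin mulr_ge0 ?g0// marginal_pdf_ge0.
  apply: ge0_le_integral_nonmeasurable => l /=; rewrite in_itv/= andbT => l0.
    by rewrite lee_fin mulr_ge0 ?g0// marginal_pdf_ge0.
  rewrite lee_fin ler_wpM2r ?marginal_pdf_ge0//.
  case: (shrinkage tau l <= u); last by rewrite mulr0.
  have m0 : 0 <= l * tau ^+ 2 by rewrite mulr_ge0 ?sqr_ge0 ?(ltW l0).
  by rewrite mulr1 invf_le1 ?lerDl// ltr_pwDl.
rewrite -[leLHS]mul1e; apply: lee_wpmul2r.
  rewrite (joint_integralE _ _ _ t0 ig0 lp0 (fun=> 1))//.
  apply: integral_ge0 => s /=; rewrite in_itv/= andbT => s0.
  apply: integral_ge0 => l /=; rewrite in_itv/= andbT => l0.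
  by rewrite lee_fin mulr_ge0// marginal_pdf_ge0.
rewrite lee_fin ler_pdivlMr// mul1r (@le_trans _ _ 1)//.
  by rewrite -real_normK ?num_real// exprn_ile1// ltW.
by rewrite lerDl ltW.
Qed.
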